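(* Let $\sigma$ be a modal signature and let $M_a$ and $N_b$ be image-finite $\sigma$-LTSs. The following are equivalent: (i) $\hom_{\mathbb{N}}(\mathcal{PG}_\sigma, M_a) = \hom_{\mathbb{N}}(\mathcal{PG}_\sigma, N_b)$; (ii) $\mathrm{gsub}(M_a) \cong \mathrm{gsub}(N_b)$; (iii) $M_a$ and $N_b$ satisfy exactly the same (nominal-free) $\mathrm{HL}(\downarrow,@)$ sentences.
   Context: A modal signature is $\sigma = \mathrm{Prop} \cup \mathbb{A}$, where $\mathrm{Prop}$ is a finite set of unary relation symbols (proposition letters) and $\mathbb{A} = \{R_i \mid i \in I\}$ ($I$ finite) is a finite set of binary relation symbols (actions). A $\sigma$-LTS $M_a$ is a (possibly infinite) $\sigma$-structure $M$ with one distinguished element $a$; it is image-finite if each state has only finitely many successors along actions in $\mathbb{A}$. A homomorphism $h:T_c\to M_a$ is a map with $h(c)=a$ preserving all unary and binary facts; an isomorphism ($\cong$) is a bijective homomorphism whose inverse is a homomorphism. $\hom_{\mathbb{N}}(T_c,M_a)$ is the number of homomorphisms $T_c\to M_a$; for a class $\mathcal{C}$ of finite $\sigma$-LTSs, $\hom_{\mathbb{N}}(\mathcal{C},M_a)$ is the $\mathcal{C}$-indexed family of these numbers, and equality means agreement at every member. A directed $\sigma$-path from $m$ to $n$ is a sequence $m=b_0,\dots,b_\ell=n$ with $R(b_j,b_{j+1})$ for some $R\in\mathbb{A}$ for each $j<\ell$. $M_a$ is point-generated if every state is reachable from $a$ by a directed $\sigma$-path; $\mathcal{PG}_\sigma$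 is the class of finite point-generated $\sigma$-LTSs. $\mathrm{gsub}(M_a)$, the submodel generated by $a$, is the smallest induced substructure of $M$ containing $a$ and closed under $R$-successors for all $R\in\mathbb{A}$, with distinguished element $a$. The hybrid logic $\mathrm{HL}(\downarrow,@)$ (without nominals) uses a countably infinite set $\mathrm{WVAR}$ of world variables and has formulas $\varphi ::= p\mid x\mid\varphi\land\varphi\mid\varphi\lor\varphi\mid\neg\varphi\mid\Diamond_i\varphi\mid\Box_i\varphi\mid{\downarrow}x.\varphi\mid @_x\varphi$ ($x\in\mathrm{WVAR}$). Under an assignment $g:\mathrm{WVAR}\to\mathrm{dom}(M)$: $M_a,g\models x$ iff $g(x)=a$; $M_a,g\models{\downarrow}x.\varphi$ iff $M_a,g[x\mapsto a]\models\varphi$; $M_a,g\models @_x\varphi$ iff $M_{g(x)},g\models\varphi$; the other clauses are the usual modal ones. A sentence is a formula with no free world variables (a variable $x$ is bound by ${\downarrow}x$); for sentences the assignment is irrelevant. *)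

(* Defs.v *)
From HB Require Import structures.
From mathcomp Require Import all_boot.
From mathcomp Require Import boolp classical_sets functions cardinality.

Set Implicit Arguments.
Unset Strict Implicit.
Unset Printing Implicit Defensive.

Local Open Scope classical_set_scope.
Local Open Scope card_scope.

Record modal_signature := ModalSignature {
  letter : finType;
  action : finType
}.

Record structure (sg : modal_signature) := Structure {
  dom :> Type;
  unary : letter sg -> dom -> Prop;
  binary : action sg -> dom -> dom -> Prop
}.
Arguments unary {sg s} p m.
Arguments binary {sg s} i m n.

Record LTS (sg : modal_signature) := MkLTS {
  model :> structure sg;
  point : model
}.
Arguments point {sg} l.

Section LTSTheory.
Variable sg : modal_signature.
Implicit Types M N T : LTS sg.

Definition image_finite M : Prop :=
  forall m : M, finite_set [set n : M | exists i, binary i m n].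

Definition homomorphism T M (h : T -> M) : Prop :=
  [/\ h (point T) = point M,
      forall p (t : T), unary p t -> unary p (h t)
    & forall i (t u : T), binary i t u -> binary i (h t) (h u)].

Definition isomorphic M N : Prop :=
  exists (f : M -> N) (g : N -> M),
    [/\ cancel f g, cancel g f, homomorphism f & homomorphism g].

Definition Hom T M : set (T -> M) := [set h | homomorphism h].
Arguments Hom : clear implicits.

(* Equality of the families of numbers of homomorphisms from the members of C:
   the numbers are compared as cardinals, so that no convention is needed for
   infinite sets of homomorphisms. *)
Definition same_hom_counts (C : LTS sg -> Prop) M N : Prop :=
  forall T, C T -> Hom T M #= Hom T N.

Definition directed_path M (m n : M) : Prop :=
  exists (l : nat) (b : nat -> M),
    [/\ b 0 = m, b l = n
      & forall j, j < l -> exists i, binary i (b j) (b j.+1)].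

Definition point_generated M : Prop :=
  forall m : M, directed_path (point M) m.

Definition PG T : Prop := finite_set [set: T] /\ point_generated T.

Definition successor_closed M (A : set M) : Prop :=
  forall i (m n : M), A m -> binary i m n -> A n.

Definition gsub_dom M : set M := smallest (@successor_closed M) [set point M].
Arguments gsub_dom : clear implicits.

Lemma point_gsub_dom M : point M \in gsub_dom M.
Proof. by apply/mem_set; exact: sub_gen_smallest. Qed.

Definition gsub M : LTS sg :=
  @MkLTS sg
    (@Structure sg (set_type (gsub_dom M))
       (fun p m => unary p (val m))
       (fun i m n => binary i (val m) (val n)))
    (exist _ (point M) (point_gsub_dom M)).

End LTSTheory.
Arguments Hom {sg} T M _.
Arguments gsub_dom {sg} M _.

Definition WVAR : Type := nat.

Inductive formula (sg : modal_signature) : Type :=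
| Letter of letter sg
| WVar of WVAR
| And of formula sg & formula sg
| Or of formula sg & formula sg
| Not of formula sg
| Dia of action sg & formula sg
| Box of action sg & formula sg
| Down of WVAR & formula sg
| At of WVAR & formula sg.

Section HybridLogic.
Variable sg : modal_signature.

Fixpoint free (x : WVAR) (phi : formula sg) : Prop :=
  match phi with
  | Letter _ => False
  | WVar y => x = y
  | And phi1 phi2 | Or phi1 phi2 => free x phi1 \/ free x phi2
  | Not phi1 | Dia _ phi1 | Box _ phi1 => free x phi1
  | Down y phi1 => x <> y /\ free x phi1
  | At y phi1 => x = y \/ free x phi1
  end.

Definition sentence (phi : formula sg) : Prop := forall x, ~ free x phi.

Definition update (D : Type) (g : WVAR -> D) (x : WVAR) (a : D) : WVAR -> D :=
  fun y => if @eq_op nat y x then a else g y.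

Fixpoint sat (M : structure sg) (g : WVAR -> M) (a : M) (phi : formula sg)
    {struct phi} : Prop :=
  match phi with
  | Letter p => unary p a
  | WVar x => g x = a
  | And phi1 phi2 => sat g a phi1 /\ sat g a phi2
  | Or phi1 phi2 => sat g a phi1 \/ sat g a phi2
  | Not phi1 => ~ sat g a phi1
  | Dia i phi1 => exists b, binary i a b /\ sat g b phi1
  | Box i phi1 => forall b, binary i a b -> sat g b phi1
  | Down x phi1 => sat (update g x a) a phi1
  | At x phi1 => sat g (g x) phi1
  end.

Lemma sat_free_ext (M : structure sg) (phi : formula sg) (g g' : WVAR -> M) a :
  (forall x, free x phi -> g x = g' x) -> sat g a phi <-> sat g' a phi.
Proof.
elim: phi g g' a => [p|x|p IHp q IHq|p IHp q IHq|p IHp|i p IHp|i p IHp|x p IHp|x p IHp]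
  g g' a /= gg'.
- by [].
- by rewrite gg'.
- by rewrite (IHp g g') ?(IHq g g') // => x ?; apply: gg'; [right|left].
- by rewrite (IHp g g') ?(IHq g g') // => x ?; apply: gg'; [right|left].
- by rewrite (IHp g g').
- by split=> -[b [ab]]; exists b; split=> //; apply/(IHp g g').
- by split=> H b ab; apply/(IHp g g') => //; apply: H.
- apply: IHp => y yp; rewrite /update; case: eqP => // yx.
  by apply: gg'.
- by rewrite (gg' x); [apply: IHp => y yp; apply: gg'; right | left].
Qed.

Lemma sat_sentence (M : structure sg) (phi : formula sg) (g g' : WVAR -> M) a :
  sentence phi -> sat g a phi <-> sat g' a phi.
Proof. by move=> sphi; apply: sat_free_ext => x /sphi. Qed.

(* The assignment is irrelevant for a sentence, by sat_sentence. *)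
Definition models (M : LTS sg) (phi : formula sg) : Prop :=
  forall g : WVAR -> M, sat g (point M) phi.

Definition HL_equiv (M N : LTS sg) : Prop :=
  forall phi, sentence phi -> (models M phi <-> models N phi).

End HybridLogic.

(* Main.v *)
(* For [d] a natural number let [ball M d] be the finite set of states reachable
   from the point of [M] in at most [d] steps; it carries a finite
   point-generated LTS.  Both the homomorphism counts and the hybrid theory of
   [M] determine which finite point-generated LTSs [T] map injectively into [M]:
   the former by the Lovasz argument (a homomorphism is an injective one from
   the quotient by its kernel, and quotients are again point-generated), the
   latter because a sentence can name the states of [T] along paths from the
   point and then assert the positive diagram of [T] and all inequalities.
   Taking for [T] the balls of [M] and of [N], an ultrafilter limit of the
   injective homomorphisms obtained embeds the generated submodels into each
   other, respecting balls; since an injective self-map of a finite set is onto,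
   these embeddings are isomorphisms.  Conversely both invariants only see the
   generated submodel. *)

From mathcomp Require Import all_boot.
From mathcomp Require Import boolp classical_sets functions cardinality filter.
From mathcomp Require Import finmap.
Require Import Defs.

Set Implicit Arguments.
Unset Strict Implicit.
Unset Printing Implicit Defensive.

Local Open Scope classical_set_scope.
Local Open Scope card_scope.

(** * Cardinalities, finite sets and finite function spaces *)

Lemma set_bij_card_eq (T U : Type) (A : set T) (B : set U) (f : T -> U) :
  set_bij A B f -> A #= B.
Proof. by move=> /Pbij[g _]; exact: pcard_eq g. Qed.

Lemma card_eq_set_bij (T U : Type) (u : U) (A : set T) (B : set U) :
  A #= B -> exists f : T -> U, set_bij A B f.
Proof.
elim/Ppointed: U => U in u B *; first by case: (no u).
by move=> /card_set_bijP.
Qed.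

(** Bijections chosen fibre by fibre are glued: [x] is sent along the bijection of its own fibre
    [k x]. Since [l] recovers [k x] from the image, points of different fibres cannot collide. *)
Lemma card_eq_fibers (T U K : Type) (u : U) (X : set T) (Y : set U)
    (k : T -> K) (l : U -> K) :
  (forall c, [set x | X x /\ k x = c] #= [set y | Y y /\ l y = c]) -> X #= Y.
Proof.
move=> XY.
have /choice[F Fbij] : forall c, exists f : T -> U,
    set_bij [set x | X x /\ k x = c] [set y | Y y /\ l y = c] f.
  by move=> c; exact: card_eq_set_bij.
apply: (@set_bij_card_eq _ _ _ _ (fun x => F (k x) x)); split.
- by move=> x Xx; case: (Fbij (k x)) => + _ _ => /(_ x (conj Xx erefl))[].
- move=> x x' /set_mem Xx /set_mem Xx' Fxx'.
  have [Fk _ _] := Fbij (k x); have [_ lk] := Fk x (conj Xx erefl).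
  have [Fk' _ _] := Fbij (k x'); have [_ lk'] := Fk' x' (conj Xx' erefl).
  have kk : k x' = k x by rewrite -lk -lk' Fxx'.
  have [_ Finj _] := Fbij (k x).
  apply: (Finj x x' (mem_set (conj Xx erefl)) (mem_set (conj Xx' kk))).
  by rewrite Fxx' kk.
- move=> y Yy; have [_ _ Fs] := Fbij (l y).
  by have [x /= [Xx <-] <-] := Fs y (conj Yy erefl); exists x.
Qed.

(** Cancellation of cardinals, which needs finiteness; the count is done on [fset_set]. *)
Lemma card_eq_setD (T U : Type) (X X' : set T) (Y Y' : set U) :
  finite_set X -> finite_set Y -> X' `<=` X -> Y' `<=` Y ->
  X #= Y -> X' #= Y' -> X `\` X' #= Y `\` Y'.
Proof.
elim/Pchoice: T => T in X X' *; elim/Pchoice: U => U in Y Y' *.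
move=> fX fY sX sY; have fX' := sub_finite_set sX fX.
have fY' := sub_finite_set sY fY.
move=> /(fcard_eq fX fY) XY /(fcard_eq fX' fY') XY'.
apply/fcard_eq; [exact: finite_setD|exact: finite_setD|].
rewrite !fset_setD // !cardfsD XY.
have capE (V : choiceType) (Z Z' : set V) : finite_set Z -> finite_set Z' ->
    Z' `<=` Z -> (fset_set Z `&` fset_set Z' = fset_set Z')%fset.
  by move=> fZ fZ' sZ; rewrite -fset_setI // setIidr.
by rewrite !capE // XY'.
Qed.

Lemma finite_inj_surj (T : Type) (A : set T) (f : T -> T) :
  finite_set A -> set_fun A A f -> set_inj A f -> A `<=` f @` A.
Proof.
elim/Pchoice: T => T in A f *.
move=> fA ff fi.
have sub : f @` A `<=` A by move=> _ [x Ax <-]; exact: ff.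
have: A `\` (f @` A) #= A `\` A.
  by apply: card_eq_setD => //; exact: inj_card_eq.
rewrite setDv card_eq0 => /eqP AD x Ax; apply: contrapT => nx.
by have : set0 x by rewrite -AD.
Qed.

Lemma finite_enum (T : Type) : T -> finite_set [set: T] ->
  exists n (e : T -> nat) (d : nat -> T),
    cancel e d /\ forall t, e t < n.
Proof.
move=> t0 [n /card_set_bijP[e [efun einj _]]]; exists n, e.
(* The property makes [t] the only possible state with code [i]; for a code that is not taken it is
   vacuous, and [t0] is the default. *)
have /choice[d dP] : forall i, exists t, forall t', e t' = i -> t' = t.
  move=> i; have [[t et]|nt] := pselect (exists t, e t = i); last first.
    by exists t0 => t' et'; case: nt; exists t'.
  by exists t => t' et'; exact: (einj _ _ (mem_set I) (mem_set I) (etrans et' (esym et))).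
exists d; split=> [t|t]; last exact: efun.
exact/esym/dP.
Qed.

Lemma finite_functions (T U : Type) (t0 : T) (B : set U) :
  finite_set [set: T] -> finite_set B ->
  finite_set [set h : T -> U | forall t, B (h t)].
Proof.
elim/Ppointed: U => U in B *.
  move=> _ _; rewrite (_ : [set _ | _] = set0) // -subset0 => h _.
  by case: (no (h t0)).
move=> /(finite_enum t0)[n [e [d [edK en]]]] [k].
rewrite card_eq_le => /andP[/pcard_surjP[s sB] _].
(* With [T] coded in ['I_n] and [B] enumerated by [s], each [h] comes from a finite function between
   codes. *)
pose F (f : {ffun 'I_n -> 'I_k}) t := s (f (Ordinal (en t))).
apply: (@sub_finite_set _ _ (range F)); last first.
  by apply: finite_image; exact: finite_finset.
move=> h /= hB; have /choice[c cP] : forall t, exists i : 'I_k, s i = h t.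
  by move=> t; have [i ik <-] := sB _ (hB t); exists (Ordinal ik).
exists [ffun i : 'I_n => c (d i)] => //.
by apply/funext => t; rewrite /F ffunE /= edK cP.
Qed.

(** * Balls and generated submodels *)

Section Balls.
Variable sg : modal_signature.
Implicit Types M N T : LTS sg.

Fixpoint ball M (k : nat) : set M :=
  if k is k'.+1 then
    @ball M k' `|` [set n | exists2 m, @ball M k' m & exists i, binary i m n]
  else [set point M].
Arguments ball : clear implicits.

Lemma ball_point M k : ball M k (point M).
Proof. by elim: k => //= k IHk; left. Qed.

Lemma ball_mono M k l : k <= l -> ball M k `<=` ball M l.
Proof.
move=> /subnK <-; elim: (l - k) => // j IHj m /IHj.
by rewrite addSn /=; left.
Qed.

Lemma ball_step M k i (m n : M) : ball M k m -> binary i m n -> ball M k.+1 n.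
Proof. by move=> km mn; right; exists m => //; exists i. Qed.

Lemma finite_ball M k : image_finite M -> finite_set (ball M k).
Proof.
move=> fM; elim: k => [|k IHk] /=; first exact: finite_set1.
rewrite finite_setU; split=> //.
rewrite (_ : [set _ | _] = \bigcup_(m in ball M k) [set n | exists i, binary i m n]).
  exact: bigcup_finite.
by apply/seteqP; split=> n [m]; exists m.
Qed.

Lemma gsub_domE M : gsub_dom M = \bigcup_k ball M k.
Proof.
apply/seteqP; split=> [m gm|m [k _]].
  apply: gm; split.
    by move=> i m' n [k _ km] mn; exists k.+1 => //; exact: ball_step mn.
  by move=> _ ->; exists 0.
elim: k m => [|k IHk] m /=; first by move=> -> A [_]; apply.
move=> [/IHk //|[m' /IHk gm' [i mn]] A AP].
by case: (AP) => Acl _; apply: Acl mn; exact: gm'.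
Qed.

Lemma directed_path_refl M (m : M) : directed_path m m.
Proof. by exists 0, (fun=> m); split. Qed.

Lemma directed_path_rcons M i (m n n' : M) :
  directed_path m n -> binary i n n' -> directed_path m n'.
Proof.
move=> [l [b [b0 bl bS]]] nn'.
exists l.+1, (fun j => if j <= l then b j else n'); split=> //; first by rewrite ltnn.
move=> j; rewrite ltnS => jl; rewrite jl.
have [jl'|lj] := ltnP j l; first exact: bS.
have jE : j = l by apply/eqP; rewrite eqn_leq jl.
by exists i; rewrite jE bl.
Qed.

Lemma point_generated_ind M (P : M -> Prop) : point_generated M ->
  P (point M) -> (forall i m n, P m -> binary i m n -> P n) -> forall m, P m.
Proof.
move=> gM P0 PS m; have [l [b [b0 <- bS]]] := gM m.
suff: forall j, j <= l -> P (b j) by apply.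
elim=> [_|j IHj jl]; first by rewrite b0.
by have [i] := bS j jl; apply: PS; exact/IHj/ltnW.
Qed.

(** A homomorphism does not increase distance from the point, so each [t] has a bound independent of
    [h]; finiteness of [T] allows taking the maximum. *)
Lemma Hom_ball T M : PG T ->
  exists k, forall h, Hom T M h -> forall t, ball M k (h t).
Proof.
move=> [fT gT].
have /choice[k kP] : forall t : T, exists k, forall h, Hom T M h -> ball M k (h t).
  apply: (point_generated_ind gT).
    by exists 0 => h [-> _ _].
  move=> i t u [k kt] tu; exists k.+1 => h hh.
  by case: (hh) => _ _ /(_ _ _ _ tu); exact/ball_step/kt.
have [n [e [d [edK en]]]] := finite_enum (point T) fT.
exists (\max_(j < n) k (d j)) => h hh t.
apply: (@ball_mono _ (k t)); last exact: kP.
by rewrite -{1}(edK t); exact: (leq_bigmax (Ordinal (en t))).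
Qed.

Lemma finite_Hom T M : PG T -> image_finite M -> finite_set (Hom T M).
Proof.
move=> PT fM; have [k kP] := Hom_ball M PT.
apply: (@sub_finite_set _ _ [set h | forall t, ball M k (h t)]) => //.
apply: finite_functions; [exact: point|by case: PT|exact: finite_ball].
Qed.

Definition ballsub M d : LTS sg :=
  @MkLTS sg
    (@Structure sg (set_type (ball M d))
       (fun p m => unary p (val m))
       (fun i m n => binary i (val m) (val n)))
    (exist _ (point M) (mem_set (ball_point M d))).

Lemma ballsub_PG M d : image_finite M -> PG (ballsub M d).
Proof.
move=> fM; split.
  by apply/card_le_finite; last exact: (finite_ball d fM); rewrite (card_le_eql (card_setT _)).
(* The carrier stays [ball M d] while the induction runs on the radius [k]: the predecessors used
   lie in smaller balls, so the path never leaves the carrier. *)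
suff path k (kd : k <= d) (m : ballsub M d) : ball M k (val m) ->
    directed_path (point (ballsub M d)) m.
  by move=> m; exact: (path d (leqnn d) m (set_valP m)).
elim: k kd m => [_|k IHk kd] m /=.
  move=> m0; rewrite (_ : m = point (ballsub M d)); first exact: directed_path_refl.
  exact: val_inj.
move=> [/IHk|[m' km' [i m'm]]]; first by apply; exact: ltnW.
have m'd : m' \in ball M d by apply/mem_set; apply: ball_mono km'; exact: ltnW.
apply: (@directed_path_rcons (ballsub M d) i _ (exist _ m' m'd)) => //.
by apply: IHk => //; exact: ltnW.
Qed.

End Balls.
Arguments ball {sg} M k _.

(** * Generated embeddings *)

Section GeneratedEmbeddings.
Variable sg : modal_signature.

(** An isomorphism onto a generated submodel: the last clause closes the image under successors. *)
Definition generated_embedding (A B : structure sg) (f : A -> B) : Prop :=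
  [/\ injective f,
      forall p a, unary p (f a) <-> unary p a,
      forall i a a', binary i (f a) (f a') <-> binary i a a'
    & forall i a b, binary i (f a) b -> exists a', f a' = b].

(** Evaluation starting in the image never leaves it: modalities move to successors, which lift by
    the last clause, and [At] jumps to values of [f \o g]. *)
Lemma sat_generated_embedding (A B : structure sg) (f : A -> B)
    (phi : formula sg) (g : WVAR -> A) (a : A) :
  generated_embedding f -> sat (f \o g) (f a) phi <-> sat g a phi.
Proof.
move=> [finj fu fbin flift].
elim: phi g a => [p|x|p IHp q IHq|p IHp q IHq|p IHp|i p IHp|i p IHp|x p IHp|x p IHp]
  g a /=.
- exact: fu.
- by split=> [/finj|->].
- by rewrite IHp IHq.
- by rewrite IHp IHq.
- by rewrite IHp.
- split=> [[b [ab satb]]|[b [ab satb]]].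
    have [b' b'E] := flift _ _ _ ab; subst b.
    by exists b'; split; [exact/fbin|exact/IHp].
  by exists (f b); split; [exact/fbin|exact/IHp].
- split=> [H b ab|H b ab]; first by apply/IHp/H/fbin.
  by have [b' b'E] := flift _ _ _ ab; subst b; apply/IHp/H/fbin.
- rewrite -IHp (_ : update (f \o g) x (f a) = f \o update g x a) //.
  by apply/funext => y; rewrite /update /=; case: ifP.
- exact: IHp.
Qed.

Lemma models_generated_embedding (A B : LTS sg) (f : A -> B) phi :
  generated_embedding f -> f (point A) = point B -> sentence phi ->
  models A phi <-> models B phi.
Proof.
move=> fE f0 sphi; split=> H g.
  (* An arbitrary assignment into [B] need not factor through [f]; for a sentence it may be replaced
     by a constant one that does. *)
  apply/(sat_sentence (f \o fun=> point A)) => //.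
  by rewrite -f0; apply/sat_generated_embedding.
by apply/(sat_generated_embedding _ _ _ fE); rewrite f0.
Qed.

(** Composition with [f] is the bijection. It is onto because [h] starts at [f (point A)] and the
    image of [f] is closed under successors, so point-generation keeps all of [h] inside that
    image. *)
Lemma Hom_generated_embedding (T A B : LTS sg) (f : A -> B) :
  point_generated T -> generated_embedding f -> f (point A) = point B ->
  Hom T A #= Hom T B.
Proof.
move=> gT [finj fu fbin flift] f0.
apply: (@set_bij_card_eq _ _ _ _ (fun h => f \o h)); split.
- move=> h [h0 hu hb]; split=> /=; first by rewrite h0.
    by move=> p t /hu /fu.
  by move=> i t u /hb /fbin.
- by move=> h h' _ _ /(congr1 (@^~ _)) hh'; apply/funext => t; apply: finj; exact: hh'.
- move=> h [h0 hu hb]; have /choice[h' h'E] : forall t : T, exists a, f a = h t.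
    apply: (point_generated_ind gT); first by exists (point A); rewrite h0.
    by move=> i t u [a aE] /hb; rewrite -aE => /flift.
  exists h'; last exact/funext.
  split; first by apply: finj; rewrite h'E h0.
    by move=> p t /hu; rewrite -h'E => /fu.
  by move=> i t u /hb; rewrite -!h'E => /fbin.
Qed.

Lemma gsub_generated_embedding (M : LTS sg) :
  generated_embedding (val : gsub M -> M).
Proof.
split=> //.
move=> i [a ga] b /= ab.
have gb : b \in gsub_dom M.
  apply/mem_set; move: (set_mem ga); rewrite gsub_domE => -[k _ ka].
  by exists k.+1 => //; exact: ball_step ab.
by exists (exist _ b gb).
Qed.

Lemma isomorphic_generated_embedding (A B : LTS sg) : isomorphic A B ->
  exists2 f : A -> B, generated_embedding f & f (point A) = point B.
Proof.
move=> [f [g [fK gK [f0 fu fb] [g0 gu gb]]]]; exists f => //.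
split; first exact: can_inj fK.
- by move=> p a; split=> [/gu|/fu //]; rewrite fK.
- by move=> i a a'; split=> [/gb|/fb //]; rewrite !fK.
- by move=> i a b _; exists (g b).
Qed.

Lemma isomorphic_bijective (A B : LTS sg) (f : A -> B) :
  generated_embedding f -> f (point A) = point B ->
  (forall b, exists a, f a = b) -> isomorphic A B.
Proof.
move=> [finj fu fb _] f0 /choice[g gK]; exists f, g.
have fK : cancel f g by move=> a; apply: finj; rewrite gK.
split=> //; split=> //.
- by move=> p a /fu.
- by move=> i a a' /fb.
- by rewrite -f0 fK.
- by move=> p b; rewrite -{1}(gK b) => /fu.
- by move=> i b b'; rewrite -{1}(gK b) -{1}(gK b') => /fb.
Qed.

Lemma isomorphic_same_hom_counts (M N : LTS sg) :
  isomorphic (gsub M) (gsub N) -> same_hom_counts (@PG sg) M N.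
Proof.
move=> /isomorphic_generated_embedding[f fE f0] T [_ gT].
have gE L := Hom_generated_embedding gT (gsub_generated_embedding L) erefl.
apply: card_eq_trans (gE N); apply: card_eq_trans (card_esym (gE M)) _.
exact: Hom_generated_embedding f0.
Qed.

Lemma isomorphic_HL_equiv (M N : LTS sg) :
  isomorphic (gsub M) (gsub N) -> HL_equiv M N.
Proof.
move=> /isomorphic_generated_embedding[f fE f0] phi sphi.
have gE L := models_generated_embedding (gsub_generated_embedding L) erefl sphi.
by rewrite -(gE M) -(gE N); exact: models_generated_embedding f0 sphi.
Qed.

End GeneratedEmbeddings.

(** * Counting injective homomorphisms *)

Section InjectiveHomomorphisms.
Variable sg : modal_signature.
Implicit Types M N T : LTS sg.

Definition Inj T M : set (T -> M) := [set h | Hom T M h /\ injective h].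
Arguments Inj : clear implicits.

(** For [q] onto this is the quotient of [T] by the kernel of [q], with the least relations making
    [q] a homomorphism. *)
Definition quotient T (D : Type) (q : T -> D) : LTS sg :=
  @MkLTS sg
    (@Structure sg D
       (fun p y => exists2 t, q t = y & unary p t)
       (fun i y z => exists t u, [/\ q t = y, q u = z & binary i t u]))
    (q (point T)).

Lemma quotient_PG T (D : Type) (q : T -> D) :
  (forall y, exists t, q t = y) -> PG T -> PG (quotient q).
Proof.
move=> qs [fT gT]; split.
  apply: (@sub_finite_set _ _ (range q)); last exact: finite_image.
  by move=> y _; have [t <-] := qs y; exists t.
suff: forall t, directed_path (point (quotient q)) (q t : quotient q).
  by move=> H y; have [t <-] := qs y.
apply: (point_generated_ind gT); first exact: directed_path_refl.
move=> i t u pt tu; apply: (directed_path_rcons (i := i) pt).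
by exists t, u.
Qed.

(** The type does not mention [U], so kernels of maps into [M] and into [N] can be compared, and can
    index the fibres on both sides. *)
Definition kernel (T U : Type) (h : T -> U) : T -> T -> Prop :=
  fun t u => h t = h u.

(** Precomposition with [q] is the bijection; its inverse is precomposition with a section [s] of
    [q]. *)
Lemma Inj_quotient T M (D : Type) (q : T -> D) :
  (forall y, exists t, q t = y) ->
  Inj (quotient q) M #= [set h | Hom T M h /\ kernel h = kernel q].
Proof.
move=> qs; have /choice[s sK] := qs.
apply: (@set_bij_card_eq _ _ _ _ (fun (g : quotient q -> M) t => g (q t))); split.
- move=> g [[g0 gu gb] ginj]; split=> /=.
    split=> //; first by move=> p t tp; apply: gu; exists t.
    by move=> i t u tu; apply: gb; exists t, u.
  apply/funext => t; apply/funext => u; apply/propext.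
  by split=> [/ginj|/= H]; rewrite ?/kernel //= H.
- move=> g g' _ _ gg'; apply/funext => y; rewrite -(sK y).
  exact: (congr1 (@^~ (s y)) gg').
- move=> h [[h0 hu hb] hq].
  have hqE t u : (h t = h u) = (q t = q u).
    exact: (congr1 (fun k => k t u) hq).
  have hsq t : h (s (q t)) = h t by rewrite hqE sK.
  exists (h \o s); last by apply/funext => t /=.
  split; last by move=> y z /=; rewrite hqE !sK.
  split=> /=; first by rewrite hsq.
    by move=> p _ [t <- tp]; rewrite hsq; exact: hu.
  by move=> i _ _ [t [u [<- <- tu]]]; rewrite !hsq; exact: hb.
Qed.

Lemma quotient_size T (D : Type) (q : T -> D) (n : nat) (e : T -> 'I_n.+1) :
  injective e -> (forall y, exists t, q t = y) -> ~ injective q ->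
  exists e' : D -> 'I_n, injective e'.
Proof.
move=> einj qs nq; have /choice[s sK] := qs.
have [t nt] : exists t, forall y, s y <> t.
  apply: contrapT => H; apply: nq.
  have sS t : exists y, s y = t.
    by apply: contrapT => nt; apply: H; exists t => y sy; apply: nt; exists y.
  by move=> t u; have [y <-] := sS t; have [z <-] := sS u; rewrite !sK => ->.
have /choice[e' e'P] : forall y, exists j, e (s y) = lift (e t) j.
  by move=> y; case: (unliftP (e t) (e (s y))) => [j ->|/einj/nt //]; exists j.
exists e' => y z yz; have : e (s y) = e (s z) by rewrite !e'P yz.
by move=> /einj /(congr1 q); rewrite !sK.
Qed.

(* Homomorphisms with kernel [ker q] are the injective homomorphisms from the
   quotient by [q]; subtracting the non-injective ones, counted by induction on
   the size of [T], leaves the injective ones. *)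
Lemma Inj_card_eq M N : image_finite M -> image_finite N ->
  same_hom_counts (@PG sg) M N -> forall T, PG T -> Inj T M #= Inj T N.
Proof.
move=> fM fN MN T PT.
have [n [e [d [edK en]]]] := finite_enum (point T) PT.1.
have : exists e' : T -> 'I_n, injective e'.
  exists (fun t => Ordinal (en t)) => t u /(congr1 val) /=; exact: can_inj edK t u.
elim: n T PT {e d edK en} => [|n IHn] T PT [e einj]; first by case: (e (point T)).
pose NI L := [set h | Hom T L h /\ ~ injective h].
have InjE L : Inj T L = Hom T L `\` NI L.
  apply/seteqP; split=> h; first by move=> [hh ih]; split=> // -[].
  by move=> [hh nh]; split=> //; apply: contrapT => ih; apply: nh.
rewrite !InjE; apply: card_eq_setD; [exact: finite_Hom|exact: finite_Hom| | |exact: MN|].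
- by move=> h [].
- by move=> h [].
(* The non-injective homomorphisms are sorted by kernel [c]. If [c] is the kernel of a surjection
   [q], the fibre is empty for [q] injective and is otherwise counted by a smaller quotient. *)
apply: (card_eq_fibers (fun=> point N) (k := @kernel T M) (l := @kernel T N)) => c.
have [[D [q [qs qc]]]|nc] :=
    pselect (exists D (q : T -> D), (forall y, exists t, q t = y) /\ kernel q = c).
  have injE U (h : T -> U) : kernel h = c -> injective h <-> injective q.
    move=> hc; have hq t u : (h t = h u) = (q t = q u).
      exact: (congr1 (fun k => k t u) (etrans hc (esym qc))).
    by split=> H t u; [rewrite -hq|rewrite hq]; exact: H.
  have fiberE L : ~ injective q ->
      [set h | NI L h /\ kernel h = c] = [set h | Hom T L h /\ kernel h = kernel q].
    move=> nq; apply/seteqP; split=> h; first by move=> [[hh _] hc]; rewrite qc.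
    by move=> [hh hc]; rewrite /= -qc; do !split=> //; rewrite (injE _ h) // hc.
  have [iq|nq] := pselect (injective q).
    have fiber0 L : [set h | NI L h /\ kernel h = c] = set0.
      by rewrite -subset0 => h [[_ nh] hc]; apply: nh; apply/(injE _ h hc).
    by rewrite !fiber0 card_eq00.
  rewrite !fiberE //.
  apply: card_eq_trans (Inj_quotient N qs).
  apply: card_eq_trans (card_esym (Inj_quotient M qs)) _.
  by apply: IHn; [exact: quotient_PG|exact: (quotient_size einj qs nq)].
(* Every [h] is a surjection onto its range, so a [c] that is no such kernel has an empty fibre. *)
have fiber0 L : [set h | NI L h /\ kernel h = c] = set0.
  rewrite -subset0 => h [_ hc]; apply: nc.
  have hr t : h t \in range h by apply/mem_set; exists t.
  exists (set_type (range h)), (fun t => exist _ (h t) (hr t)); split.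
    by move=> [y yr]; have [t _ ty] := set_mem yr; exists t; exact: val_inj.
  rewrite -hc; apply/funext => t; apply/funext => u; apply/propext.
  by split=> [/(congr1 val)|H] //; exact: val_inj.
by rewrite !fiber0 card_eq00.
Qed.

Lemma same_hom_counts_Inj M N : image_finite M -> image_finite N ->
  same_hom_counts (@PG sg) M N ->
  forall T, PG T -> (exists h, Inj T M h) -> exists h, Inj T N h.
Proof.
move=> fM fN MN T PT [h hI].
have /(card_eq_set_bij (fun=> point N))[F [Ffun _ _]] := Inj_card_eq fM fN MN PT.
by exists (F h); exact: Ffun.
Qed.

End InjectiveHomomorphisms.
Arguments Inj {sg} T M _.

(** * Isomorphism of generated submodels from injective homomorphisms *)

(** If no value were taken [G]-almost everywhere, the complements of the finitely many level sets
    would all lie in [G], and their intersection with the preimage of [B] is empty. *)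
Lemma ultra_finite (I T : Type) (G : set_system I) (f : I -> T) (B : set T) :
  UltraFilter G -> finite_set B -> G [set i | B (f i)] ->
  exists n, G [set i | f i = n].
Proof.
elim/Pchoice: T => T in f B *; move=> GU /finite_fsetP[X ->] GB.
apply: contrapT => nG.
have GC n : G (~` [set i | f i = n]).
  by have [Gn|//] := in_ultra_setVsetC [set i | f i = n] GU; case: nG; exists n.
have GI : G (\bigcap_(n in [set` X]) ~` [set i | f i = n]).
  by apply: filter_bigI => n _; exact: GC.
have [i [iX iN]] := filter_ex (filterI GB GI).
exact: (iN (f i) iX).
Qed.

Section LocalEmbeddings.
Variable sg : modal_signature.
Implicit Types M N T : LTS sg.

(** The map is total, with values outside [ball M d] unconstrained, so that pointwise limits make
    sense. Facts are only preserved; their reflection is obtained later by counting. *)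
Definition local_embedding M N d (h : M -> N) : Prop :=
  [/\ h (point M) = point N,
      forall p m, ball M d m -> unary p m -> unary p (h m),
      forall i m m', ball M d m -> ball M d m' -> binary i m m' ->
        binary i (h m) (h m')
    & forall m m', ball M d m -> ball M d m' -> h m = h m' -> m = m'].

Lemma local_embedding_ball M N d (h : M -> N) k m :
  local_embedding d h -> k <= d -> ball M k m -> ball N k (h m).
Proof.
move=> [h0 _ hb _]; elim: k m => [|k IHk] m kd; first by move=> ->.
move=> [/(IHk _ (ltnW kd)) ?|[m' km' [i mm']]]; first by left.
have sub := @ball_mono _ M _ _ kd.
apply: (ball_step (IHk _ (ltnW kd) km') (hb i _ _ _ _ mm')).
  by apply: sub; left.
by apply: sub; exact: ball_step mm'.
Qed.

Lemma Inj_local_embedding M N : image_finite M ->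
  (forall T, PG T -> (exists h, Inj T M h) -> exists h, Inj T N h) ->
  forall d, exists h : M -> N, local_embedding d h.
Proof.
move=> fM MN d; have [|g [[g0 gu gb] ginj]] := MN _ (ballsub_PG d fM).
  by exists val; split; [split|exact: val_inj].
(* Extension of [g] from the ball to a total map: quantifying over membership proofs makes the
   condition vacuous off the ball, where [point N] is the default. *)
have /choice[h hE] : forall m, exists n, forall md : m \in ball M d,
    n = g (exist _ m md).
  move=> m; have [md|nmd] := pselect (m \in ball M d); last first.
    by exists (point N).
  by exists (g (exist _ m md)) => md'; rewrite (bool_irrelevance md md').
exists h; split.
- by rewrite (hE _ (mem_set (ball_point M d))); exact: g0.
- by move=> p m /mem_set md pm; rewrite (hE m md); exact: gu.
- move=> i m m' /mem_set md /mem_set md' mm'.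
  by rewrite (hE m md) (hE m' md'); exact: gb.
- move=> m m' /mem_set md /mem_set md'.
  by rewrite (hE m md) (hE m' md') => /ginj /(congr1 val).
Qed.

Lemma local_embedding_limit M N (h_ : nat -> M -> N) : image_finite N ->
  (forall d, local_embedding d (h_ d)) ->
  exists h : M -> N, forall d, local_embedding d h.
Proof.
move=> fN h_E.
(* A free ultrafilter on the radii: each set of all sufficiently large [e] belongs to it. *)
have [G [GU ooG]] := ultraFilterLemma eventually_filter.
have Gge d : G [set e | d <= e] by apply: ooG; exists d.
have /choice[h hE] : forall m, exists n, forall k, ball M k m ->
    G [set d | h_ d m = n].
  move=> m; have [[k km]|nk] := pselect (exists k, ball M k m); last first.
    by exists (point N) => k km; case: nk; exists k.
  (* For [d >= k] the values [h_ d m] stay in the finite set [ball N k], so [G] selects one of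
     them. *)
  have [||n Gn] := @ultra_finite _ _ G (h_^~ m) (ball N k).
  - exact: finite_ball.
  - by apply: filterS (Gge k) => d /= kd; exact: (local_embedding_ball (h_E d) kd).
  - by exists n.
(* Each clause of [local_embedding] speaks of at most two states, and on two states the limit
   coincides with some [h_ e] of radius at least [d]. *)
have agree d m m' : ball M d m -> ball M d m' ->
    exists e, [/\ d <= e, h_ e m = h m & h_ e m' = h m'].
  move=> dm dm'.
  have [e [[/= em em'] de]] :=
    filter_ex (filterI (filterI (hE _ _ dm) (hE _ _ dm')) (Gge d)).
  by exists e.
exists h => d; split.
- have [e [_ <- _]] := agree 0 _ _ (ball_point M 0) (ball_point M 0).
  by case: (h_E e).
- move=> p m dm pm; have [e [de <- _]] := agree d m m dm dm.
  by have [_ hu _ _] := h_E e; apply: hu => //; exact: ball_mono dm.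
- move=> i m m' dm dm' mm'; have [e [de <- <-]] := agree d m m' dm dm'.
  by have [_ _ hb _] := h_E e; apply: hb => //; exact: ball_mono de _ _.
- move=> m m' dm dm'; have [e [de <- <-]] := agree d m m' dm dm'.
  by have [_ _ _] := h_E e; apply; exact: ball_mono de _ _.
Qed.

Section BackAndForth.
Variables (M N : LTS sg) (fM : image_finite M) (fN : image_finite N).
Variables (h : M -> N) (h' : N -> M).
Hypothesis hE : forall d, local_embedding d h.
Hypothesis h'E : forall d, local_embedding d h'.

Let ball_back d m : ball M d m -> ball M d (h' (h m)).
Proof.
by move=> dm; apply: (local_embedding_ball (h'E d)) => //;
  exact: (local_embedding_ball (hE d)).
Qed.

Let back_inj d m m' : ball M d m -> ball M d m' -> h' (h m) = h' (h m') -> m = m'.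
Proof.
have [_ _ _ hinj] := hE d; have [_ _ _ h'inj] := h'E d.
by move=> dm dm' /h'inj H; apply: hinj => //; apply: H;
  exact: (local_embedding_ball (hE d)).
Qed.

(* The facts true in a ball form a finite set that [h' \o h] maps injectively
   into itself, hence onto itself. *)
Let unary_reflect d p m : ball M d m -> unary p (h m) -> unary p m.
Proof.
move=> dm phm; have [_ hu _ _] := hE d; have [_ h'u _ _] := h'E d.
pose E := ball M d `&` [set m | unary p m].
have [|||| m' [dm' pm'] /(back_inj dm' dm) <- //] :=
    @finite_inj_surj _ E (h' \o h) _ _ _ (h' (h m)).
- exact/finite_setIl/finite_ball.
- move=> x [dx px]; split; first exact: ball_back.
  by apply: h'u; [exact: (local_embedding_ball (hE d))|exact: hu].
- by move=> x y /set_mem[dx _] /set_mem[dy _]; exact: (back_inj dx dy).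
- by split; [exact: ball_back|apply: h'u => //; exact: (local_embedding_ball (hE d))].
Qed.

Let binary_reflect d i m n :
  ball M d m -> ball M d n -> binary i (h m) (h n) -> binary i m n.
Proof.
move=> dm dn hmn; have [_ _ hb _] := hE d; have [_ _ h'b _] := h'E d.
(* The argument for letters, now on related pairs of states. *)
pose E := (ball M d `*` ball M d) `&` [set x | binary i x.1 x.2].
have [|||| [m' n'] [[/= dm' dn'] mn'] [hm hn]] :=
    @finite_inj_surj _ E (fun x => (h' (h x.1), h' (h x.2))) _ _ _
      (h' (h m), h' (h n)).
- by apply/finite_setIl/finite_setX; exact: finite_ball.
- move=> [x y] [[/= dx dy] xy]; split; first by split; exact: ball_back.
  have hd := local_embedding_ball (hE d) (leqnn d).
  by apply: h'b; [exact: hd|exact: hd|exact: hb].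
- move=> [x y] [x' y'] /set_mem[[/= dx dy] _] /set_mem[[/= dx' dy'] _] [xx' yy'].
  by rewrite (back_inj dx dx' xx') (back_inj dy dy' yy').
- split; first by split; exact: ball_back.
  by apply: h'b => //; exact: (local_embedding_ball (hE d)).
- by rewrite -(back_inj dm' dm hm) -(back_inj dn' dn hn).
Qed.

(** The other composite [h \o h'] is an injective self-map of the finite [ball N d], hence onto, and
    [h'] supplies the preimage under [h]. *)
Let ball_onto d n : ball N d n -> exists2 m, ball M d m & h m = n.
Proof.
move=> dn; have [_ _ _ hinj] := hE d; have [_ _ _ h'inj] := h'E d.
have h'd x : ball N d x -> ball M d (h' x).
  exact: (local_embedding_ball (h'E d)).
have hd x : ball M d x -> ball N d (h x) by exact: (local_embedding_ball (hE d)).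
have [|||| n' dn' <-] := @finite_inj_surj _ (ball N d) (h \o h') _ _ _ n.
- exact: finite_ball.
- by move=> x dx; exact/hd/h'd.
- move=> x y /set_mem dx /set_mem dy /hinj xy.
  by apply: h'inj => //; apply: xy; exact: h'd.
- by [].
- by exists (h' n') => //; exact: h'd.
Qed.

Lemma back_and_forth_isomorphic : isomorphic (gsub M) (gsub N).
Proof.
have in_gsub (L : LTS sg) (x : gsub L) : exists k, ball L k (val x).
  by case: x => x gx /=; move: (set_mem gx); rewrite gsub_domE => -[k _]; exists k.
have common (m m' : gsub M) : exists k, ball M k (val m) /\ ball M k (val m').
  have [k km] := in_gsub _ m; have [l lm'] := in_gsub _ m'.
  exists (maxn k l); split.
    exact: (ball_mono (leq_maxl k l)).
  exact: (ball_mono (leq_maxr k l)).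
have hg (m : gsub M) : h (val m) \in gsub_dom N.
  have [k km] := in_gsub _ m; apply/mem_set; rewrite gsub_domE; exists k => //.
  exact: (local_embedding_ball (hE k)).
pose f (m : gsub M) : gsub N := exist _ (h (val m)) (hg m).
have fsurj n : exists m, f m = n.
  have [k kn] := in_gsub _ n; have [m km hm] := ball_onto kn.
  have gm : m \in gsub_dom M by apply/mem_set; rewrite gsub_domE; exists k.
  by exists (exist _ m gm); exact: val_inj.
apply: (isomorphic_bijective (f := f)) => //; last first.
  by apply: val_inj => /=; case: (hE 0).
split.
- move=> m m' /(congr1 val) /= hmm'; have [k [km km']] := common m m'.
  by apply: val_inj; case: (hE k) => _ _ _; apply.
- move=> p m; have [k km] := in_gsub _ m; split; first exact: unary_reflect km.
  by case: (hE k) => _ hu _ _; exact: hu.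
- move=> i m m'; have [k [km km']] := common m m'; split.
    exact: binary_reflect km km'.
  by case: (hE k) => _ _ hb _; exact: hb.
- by move=> i m n _; exact: fsurj.
Qed.

End BackAndForth.

Lemma Inj_isomorphic M N : image_finite M -> image_finite N ->
  (forall T, PG T -> (exists h, Inj T M h) -> exists h, Inj T N h) ->
  (forall T, PG T -> (exists h, Inj T N h) -> exists h, Inj T M h) ->
  isomorphic (gsub M) (gsub N).
Proof.
move=> fM fN MN NM.
have /choice[h_ /(local_embedding_limit fN)[h hE]] := Inj_local_embedding fM MN.
have /choice[h'_ /(local_embedding_limit fM)[h' h'E]] := Inj_local_embedding fN NM.
exact: back_and_forth_isomorphic hE h'E.
Qed.

End LocalEmbeddings.

(** * A sentence expressing the existence of an injective homomorphism *)

Section Diagram.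
Variable sg : modal_signature.
Implicit Types M N T : LTS sg.

(** The signature may have no letters, so a tautology is built on variable 0. That variable then
    occurs free, and is bound at the end by the outer [Down 0]. *)
Definition verum : formula sg := Or (WVar sg 0) (Not (WVar sg 0)).

Lemma sat_verum (M : structure sg) (g : WVAR -> M) a : sat g a verum.
Proof. exact: EM. Qed.

Definition conjunction (I : Type) (s : seq I) (F : I -> formula sg) : formula sg :=
  foldr (fun i => And (F i)) verum s.

Lemma sat_conjunction (I : eqType) (s : seq I) (F : I -> formula sg)
    (M : structure sg) (g : WVAR -> M) a :
  sat g a (conjunction s F) <-> forall i, i \in s -> sat g a (F i).
Proof.
elim: s => [|j s IHs]; first by split=> // _; exact: sat_verum.
rewrite [sat _ _ _]/= IHs; split=> [[Fj Fs] i|H].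
  by rewrite inE => /orP[/eqP -> //|/Fs].
by split=> [|i si]; apply: H; rewrite inE ?eqxx ?si ?orbT.
Qed.

Lemma free_conjunction (I : eqType) (s : seq I) (F : I -> formula sg) x :
  free x (conjunction s F) -> x = 0 \/ exists2 i, i \in s & free x (F i).
Proof.
elim: s => [|j s IHs] /=; first by case; left.
move=> [Fj|/IHs[->|[i si Fi]]]; [right|by left|right].
  by exists j => //; rewrite inE eqxx.
by exists i => //; rewrite inE si orbT.
Qed.

(** [P] is a fact about [T], decided classically outside the logic: the clause is kept only where
    [T] calls for it. *)
Definition guard (P : Prop) (phi : formula sg) : formula sg :=
  if `[< P >] then phi else verum.

Lemma sat_guard P phi (M : structure sg) (g : WVAR -> M) a :
  sat g a (guard P phi) <-> (P -> sat g a phi).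
Proof.
rewrite /guard; case: asboolP => p; first by split=> // /(_ p).
by split=> // _; exact: sat_verum.
Qed.

Lemma free_guard P phi x : free x (guard P phi) -> x = 0 \/ free x phi.
Proof. by rewrite /guard; case: ifP => _; [right|case; left]. Qed.

Definition diamonds (w : seq (action sg)) (phi : formula sg) : formula sg :=
  foldr (@Dia sg) phi w.

(** Unlike [directed_path] this records the actions, which [diamonds] must spell out. *)
Fixpoint walk (M : structure sg) (w : seq (action sg)) (a b : M) : Prop :=
  if w is i :: w' then exists c, binary i a c /\ walk w' c b else a = b.

Lemma sat_diamonds (M : structure sg) (g : WVAR -> M) w phi a :
  sat g a (diamonds w phi) <-> exists b, walk w a b /\ sat g b phi.
Proof.
elim: w a => [|i w IHw] a /=; first by split=> [|[b [->]] //]; exists a.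
split=> [[c [ac /IHw[b [cb ?]]]]|[b [[c [ac cb]] ?]]].
  by exists b; split=> //; exists c.
by exists c; split=> //; apply/IHw; exists b.
Qed.

Lemma free_diamonds w phi x : free x (diamonds w phi) -> free x phi.
Proof. by elim: w. Qed.

Lemma walk_rcons (M : structure sg) w i (a b c : M) :
  walk w a b -> binary i b c -> walk (rcons w i) a c.
Proof.
elim: w a => [|j w IHw] a /=; first by move=> ->; exists c.
by move=> [d [ad db]] bc; exists d; split=> //; exact: IHw bc.
Qed.

Lemma walk_homomorphism T M (h : T -> M) w t u :
  homomorphism h -> walk w t u -> walk w (h t) (h u).
Proof.
move=> hh; elim: w t => [|i w IHw] t /=; first by move=> ->.
move=> [c [tc cu]]; exists (h c); split; last exact: IHw.
by case: hh => _ _; apply.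
Qed.

Lemma point_generated_walk T : point_generated T ->
  forall t : T, exists w, walk w (point T) t.
Proof.
move=> gT; apply: (point_generated_ind gT); first by exists [::].
by move=> i t u [w wt] tu; exists (rcons w i); exact: walk_rcons wt tu.
Qed.

(* Variable 0 names the point, variable [j.+1] the state number [j], which is
   reached from the point along the word [w j]. *)
Fixpoint bind_states (w : nat -> seq (action sg)) n (phi : formula sg) : formula sg :=
  if n is j.+1 then At 0 (diamonds (w j) (Down j.+1 (bind_states w j phi)))
  else phi.

(** [v j] is the intended value of variable [j.+1]. The final state [b] is left arbitrary: the
    formula used for [phi] is a conjunction of [At] clauses and [verum]. *)
Lemma sat_bind_states_intro M w n phi (v : nat -> M) (g : WVAR -> M) a :
  (forall g' b, (forall x, (x == 0) || (n < x) -> g' x = g x) ->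
     (forall j, j < n -> g' j.+1 = v j) -> sat g' b phi) ->
  (forall j, j < n -> walk (w j) (g 0) (v j)) ->
  sat g a (bind_states w n phi).
Proof.
elim: n g a => [|n IHn] g a /= H wv; first exact: H.
apply/sat_diamonds; exists (v n); split; first exact: wv.
apply: IHn => [g' b g'E g'v|j jn]; last by rewrite /update; apply: wv; exact: ltnW.
apply: H => [x /orP[/eqP ->|nx]|j].
- by rewrite g'E.
- rewrite g'E ?(ltnW nx) ?orbT // /update.
  by case: eqP => // xn; move: nx; rewrite xn ltnn.
- rewrite ltnS leq_eqVlt => /orP[/eqP ->|]; last exact: g'v.
  by rewrite g'E ?ltnSn ?orbT // /update eqxx.
Qed.

Lemma sat_bind_states_elim M w n phi (g : WVAR -> M) a :
  sat g a (bind_states w n phi) -> exists g' b, g' 0 = g 0 /\ sat g' b phi.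
Proof.
elim: n g a => [|n IHn] g a /=; first by exists g, a.
by move=> /sat_diamonds[b [_ /= /IHn[g' [c [g'0 gc]]]]]; exists g', c.
Qed.

Lemma free_bind_states w n phi x : free x (bind_states w n phi) ->
  x = 0 \/ free x phi /\ (n < x).
Proof.
elim: n => [|n IHn] /=.
  by case: x => [|x]; [left|right].
move=> [->|/free_diamonds /= [xn /IHn[->|[xphi nx]]]]; [by left|by left|right].
by split=> //; rewrite ltn_neqAle nx andbT; apply/eqP => H; apply: xn.
Qed.

Section InjSentence.
Variables (T : LTS sg) (n : nat) (e : T -> nat) (d : nat -> T).
Hypotheses (edK : cancel e d) (en : forall t, e t < n).

(** The first clause makes the name of the point of [T] agree with variable 0; then come the
    positive facts and the inequalities. A code outside the range of [e] merely gives one more name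
    to the state [d j]. *)
Definition diagram : formula sg :=
  And (At 0 (WVar sg (e (point T)).+1))
 (And (conjunction (iota 0 n) (fun j => conjunction (enum (letter sg)) (fun p =>
         guard (unary p (d j)) (At j.+1 (Letter p)))))
 (And (conjunction (iota 0 n) (fun j => conjunction (iota 0 n) (fun k =>
         conjunction (enum (action sg)) (fun i =>
         guard (binary i (d j) (d k)) (At j.+1 (Dia i (WVar sg k.+1)))))))
      (conjunction (iota 0 n) (fun j => conjunction (iota 0 n) (fun k =>
         guard (d j <> d k) (At j.+1 (Not (WVar sg k.+1)))))))).

Lemma sat_diagram M (g : WVAR -> M) a :
  sat g a diagram <->
  [/\ g (e (point T)).+1 = g 0,
      forall j p, j < n -> unary p (d j) -> unary p (g j.+1),
      forall j k i, j < n -> k < n -> binary i (d j) (d k) ->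
        binary i (g j.+1) (g k.+1)
    & forall j k, j < n -> k < n -> d j <> d k -> g k.+1 <> g j.+1].
Proof.
split.
  move=> [g0 [/sat_conjunction gu [/sat_conjunction gb /sat_conjunction gn]]]; split=> //.
  - move=> j p jn; have := gu j; rewrite mem_iota /= add0n jn => /(_ isT).
    by move=> /sat_conjunction/(_ p); rewrite mem_enum => /(_ isT)/sat_guard.
  - move=> j k i jn kn jk; have := gb j; rewrite mem_iota /= add0n jn => /(_ isT).
    move=> /sat_conjunction/(_ k); rewrite mem_iota /= add0n kn => /(_ isT).
    move=> /sat_conjunction/(_ i); rewrite mem_enum => /(_ isT)/sat_guard/(_ jk).
    by move=> [b [jb gk]]; rewrite [g k.+1]gk.
  - move=> j k jn kn; have := gn j; rewrite mem_iota /= add0n jn => /(_ isT).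
    move=> /sat_conjunction/(_ k); rewrite mem_iota /= add0n kn => /(_ isT).
    by move=> /sat_guard.
move=> [g0 gu gb gn]; split=> //; do !split; apply/sat_conjunction => j;
  rewrite mem_iota /= add0n => jn; apply/sat_conjunction.
- by move=> p _; apply/sat_guard; exact: gu.
- move=> k; rewrite mem_iota /= add0n => kn; apply/sat_conjunction => i _.
  by apply/sat_guard => jk /=; exists (g k.+1); split=> //; exact: gb.
- by move=> k; rewrite mem_iota /= add0n => kn; apply/sat_guard; exact: gn.
Qed.

Lemma free_diagram x : free x diagram -> x <= n.
Proof.
have hd s : s \in iota 0 n -> s < n by rewrite mem_iota.
move=> [[->|->]|[|[|]]] //=.
- move=> /free_conjunction[-> //|[j /hd jn /free_conjunction[-> //|[p _]]]].
  by move=> /free_guard[-> //|[-> //|[]]].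
- move=> /free_conjunction[-> //|[j /hd jn /free_conjunction[-> //|[k /hd kn]]]].
  move=> /free_conjunction[-> //|[i _]].
  by move=> /free_guard[-> //|[-> //|/= ->]].
- move=> /free_conjunction[-> //|[j /hd jn /free_conjunction[-> //|[k /hd kn]]]].
  by move=> /free_guard[-> //|[-> //|/= ->]].
Qed.

Definition inj_sentence (w : nat -> seq (action sg)) : formula sg :=
  Down 0 (bind_states w n diagram).

(** [bind_states] captures the variables from 1 to [n], [Down 0] captures 0, and [diagram] has none
    above [n]. *)
Lemma sentence_inj_sentence w : sentence (inj_sentence w).
Proof.
move=> x /= [x0 /free_bind_states[//|[/free_diagram xn]]].
by rewrite ltnNge xn.
Qed.

(** Variable [j.+1] takes the value [h (d j)], reachable along [w j] because homomorphisms preserve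
    walks. *)
Lemma Inj_models_inj_sentence M (h : T -> M) w : Inj T M h ->
  (forall j, walk (w j) (point T) (d j)) -> models M (inj_sentence w).
Proof.
move=> [hh hinj] wd g /=; case: (hh) => h0 hu hb.
apply: (@sat_bind_states_intro _ _ _ _ (h \o d)) => [g' b g'E g'v|j jn]; last first.
  by rewrite /update /= -h0; exact: walk_homomorphism.
apply/sat_diagram; split.
- by rewrite g'v // g'E //= edK h0.
- by move=> j p jn jp; rewrite g'v //; exact: hu.
- by move=> j k i jn kn jk; rewrite !g'v //; exact: hb.
- by move=> j k jn kn jk; rewrite !g'v // => /hinj/esym.
Qed.

Lemma models_inj_sentence_Inj M w : models M (inj_sentence w) ->
  exists h, Inj T M h.
Proof.
move=> /(_ (fun=> point M)) /= /sat_bind_states_elim[g [b [g0 /sat_diagram]]].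
(* The homomorphism reads off the value of the variable that names each state. *)
move=> [gpt gu gb gn]; exists (fun t => g (e t).+1); split; [split|].
- by rewrite gpt g0.
- by move=> p t tp; apply: gu => //; rewrite edK.
- by move=> i t u tu; apply: gb => //; rewrite !edK.
- move=> t u gtu; apply: contrapT => tu.
  by apply: (gn (e u) (e t)) => //; rewrite !edK => /esym.
Qed.

End InjSentence.

Lemma HL_equiv_Inj M N : HL_equiv M N ->
  forall T, PG T -> (exists h, Inj T M h) -> exists h, Inj T N h.
Proof.
move=> MN T [fT gT] [h hI].
have [n [e [d [edK en]]]] := finite_enum (point T) fT.
have /choice[w wP] : forall j, exists w, walk w (point T) (d j).
  by move=> j; exact: point_generated_walk.
apply: (models_inj_sentence_Inj edK en (w := w)).
apply/(MN _ (@sentence_inj_sentence _ _ _ d en w)).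
exact: Inj_models_inj_sentence hI wP.
Qed.

End Diagram.

Theorem theorem5p4 (sg : modal_signature) (M N : LTS sg)
  (hM : image_finite M) (hN : image_finite N) :
  (same_hom_counts (@PG sg) M N <-> isomorphic (gsub M) (gsub N)) /\
  (isomorphic (gsub M) (gsub N) <-> HL_equiv M N).
Proof.
split; split.
- move=> MN; apply: Inj_isomorphic => //; apply: same_hom_counts_Inj => //.
  by move=> T PT; exact/card_esym/MN.
- exact: isomorphic_same_hom_counts.
- exact: isomorphic_HL_equiv.
- move=> MN; apply: Inj_isomorphic => //; apply: HL_equiv_Inj => //.
  by move=> phi sphi; apply: iff_sym; exact: MN.
Qed.
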